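(* Let $\mathcal{H}$ be a real Hilbert space, let $\mathcal{Y}\subset \mathcal{H}$ be non-empty, and let $f: \mathcal{Y} \to \mathcal{H}$. (a) The following properties are equivalent: (i) there is $\varphi: \mathcal{H} \to \mathbb{R} \cup \{+\infty\}$ such that $f(y) \in \mathrm{prox}_{\varphi}(y)$ for each $y \in \mathcal{Y}$; (ii) there is a convex lower semicontinuous $g: \mathcal{H} \to \mathbb{R} \cup \{+\infty\}$ such that $f^{-1}(x) \subset \partial g(x)$ for each $x \in \mathrm{Im}(f)$; (iii) there is a convex lower semicontinuous $\psi: \mathcal{H} \to \mathbb{R} \cup \{+\infty\}$ such that $f(y) \in \partial \psi(y)$ for each $y \in \mathcal{Y}$. When they hold, there exists a choice of $\varphi,g,\psi$ satisfying (i), (ii), (iii) respectively such that $$g(x)+\chi_{\mathrm{Im}(f)}(x) = \tfrac{1}{2}\|x\|^{2}+\varphi(x),\quad \forall x \in \mathcal{H};$$ $$\psi(y) = \langle y,f(y)\rangle-\tfrac{1}{2}\|f(y)\|^{2}-\varphi(f(y)),\quad \forall y \in \mathcal{Y}.$$ (b) Let $\varphi$, $g$ and $\psi$ satisfy (i), (ii) and (iii), respectively. Let $\mathcal{C} \subset \mathrm{Im}(f)$ and $\mathcal{C}' \subset \mathcal{Y}$ be polygonally connected. Then there exist $K,K' \in \mathbb{R}$ such that $$g(x) = \tfrac{1}{2}\|x\|^2+\varphi(x) + K,\quad \forall x \in \mathcal{C};$$ $$\psi(y) = \langle y,f(y)\rangle -\tfrac{1}{2}\|f(y)\|^2-\varphi(f(y))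 + K',\quad \forall y \in \mathcal{C}'.$$
   Context: For $\varphi: \mathcal{H} \to \mathbb{R}\cup\{+\infty\}$, $\mathrm{prox}_\varphi(y) := \arg\min_{x \in \mathcal{H}} \{\tfrac12\|y-x\|^2 + \varphi(x)\}$ is the set of global minimizers (a minimizer is required to have finite objective value). $\mathrm{Im}(f)=f(\mathcal{Y})$ and $f^{-1}(x)=\{y\in\mathcal{Y}: f(y)=x\}$. $\chi_{\mathcal S}(x)=0$ if $x\in\mathcal S$ and $+\infty$ otherwise. For $\theta:\mathcal{H}\to\mathbb{R}\cup\{+\infty\}$, $\partial\theta(x)$ is the set of $u\in\mathcal{H}$ with $\theta(x')\geq\theta(x)+\langle u,x'-x\rangle$ for all $x'\in\mathcal{H}$ when $\theta(x)<+\infty$, and $\partial\theta(x)=\varnothing$ when $\theta(x)=+\infty$. A non-empty subset $\mathcal{C}\subset\mathcal{H}$ is polygonally connected if any two points $x,x'\in\mathcal{C}$ can be joined by a polygonal path in $\mathcal{C}$, i.e. there are $x_0=x,x_1,\dots,x_n=x'$ with each segment $[x_{i-1},x_i]\subset\mathcal{C}$. *)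

(* Defs.v *)
From HB Require Import structures.
From mathcomp Require Import all_boot all_order all_algebra.
From mathcomp Require Import all_classical all_reals all_analysis.
Set Implicit Arguments.
Unset Strict Implicit.
Unset Printing Implicit Defensive.
Import Order.TTheory GRing.Theory Num.Theory.
Import numFieldNormedType.Exports.
Local Open Scope classical_set_scope.
Local Open Scope ring_scope.
Local Open Scope ereal_scope.

(* MathComp-Analysis has no Hilbert space structure.  A real Hilbert space is
   presented as a complete normed module [H] over [R : realType] together with
   a form [dot : {dot H for idfun}] (bilinear, symmetric, positive definite)
   which induces the norm of [H], see [hilbert_norm].  Functions with values in
   R U {+oo} are functions to [\bar R] satisfying [ninfty_free].  A function
   on a subset [Y] of [H] has the subtype attached to [Y] as its domain. *)

Definition hilbert_norm (R : realType) (H : completeNormedModType R)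
    (dot : {dot H for idfun}) : Prop :=
  forall x : H, `|x|%R = Num.sqrt (dot x x).

Definition ninfty_free (R : realType) (T : Type) (theta : T -> \bar R) : Prop :=
  forall x, theta x != -oo.

Definition econvex (R : realType) (H : lmodType R) (theta : H -> \bar R) : Prop :=
  forall (x x' : H) (t : R), (0 < t < 1)%R ->
    theta (t *: x + (1 - t) *: x')%R <= t%:E * theta x + (1 - t)%:E * theta x'.

Definition chi (R : realType) (T : Type) (S : set T) (x : T) : \bar R :=
  if x \in S then 0 else +oo.
Arguments chi R {T} S x.

Definition prox_objective (R : realType) (H : normedModType R)
    (phi : H -> \bar R) (y x : H) : \bar R :=
  (2^-1 * `|y - x| ^+ 2)%:E + phi x.

Definition prox (R : realType) (H : normedModType R)
    (phi : H -> \bar R) (y : H) : set H :=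
  [set x | prox_objective phi y x \is a fin_num /\
           forall x', prox_objective phi y x <= prox_objective phi y x'].

Definition subdiff (R : realType) (H : lmodType R) (dot : {dot H for idfun})
    (theta : H -> \bar R) (x : H) : set H :=
  [set u | theta x < +oo /\
           forall x', theta x + (dot u (x' - x)%R)%:E <= theta x'].

Definition segment (R : realType) (H : lmodType R) (x x' : H) : set H :=
  [set ((1 - t) *: x + t *: x')%R | t in [set t : R | (0 <= t <= 1)%R]].

Definition polygonally_connected (R : realType) (H : lmodType R)
    (C : set H) : Prop :=
  C !=set0 /\
  forall x x', C x -> C x' ->
    exists (n : nat) (p : nat -> H), [/\ p 0%N = x, p n = x' &
      forall i, (i < n)%N -> segment (p i) (p i.+1) `<=` C].

Definition selects_prox (R : realType) (H : completeNormedModType R)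
    (Y : set H) (f : Y -> H) (phi : H -> \bar R) : Prop :=
  ninfty_free phi /\ forall y : Y, prox phi (val y) (f y).

Definition inverse_in_subdiff (R : realType) (H : completeNormedModType R)
    (dot : {dot H for idfun}) (Y : set H) (f : Y -> H) (g : H -> \bar R) : Prop :=
  [/\ ninfty_free g, econvex g, lower_semicontinuous g &
      forall x, range f x -> val @` (f @^-1` [set x]) `<=` subdiff dot g x].

Definition selects_subdiff (R : realType) (H : completeNormedModType R)
    (dot : {dot H for idfun}) (Y : set H) (f : Y -> H) (psi : H -> \bar R) : Prop :=
  [/\ ninfty_free psi, econvex psi, lower_semicontinuous psi &
      forall y : Y, subdiff dot psi (val y) (f y)].

(* Main.v *)
(* With theta(x) = |x|^2/2 + phi(x), expanding |y - x|^2 turns x \in prox_phi(y)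
   into y \in subdiff theta(x), without any convexity of phi.  Taking suprema of
   affine functions (the conjugate of theta restricted to Im(f), then the
   conjugate of psi restricted to Y) preserves the subgradient relation between
   y and f(y) and the values there, which gives (a).
   For (b), theta and g share the subgradient y at f(y), while psi and the
   conjugate of theta share f(y) at y.  On a segment, two functions with a
   common subgradient slope s, which is then nondecreasing, have increments over
   a step d differing by at most d times the increment of s; summing over N equal
   steps bounds the total discrepancy by (s(1) - s(0)) / N. *)
Require Import Defs.
From HB Require Import structures.
From mathcomp Require Import all_boot all_order all_algebra.
From mathcomp Require Import all_classical all_reals all_analysis.
From mathcomp Require Import ring lra.
Set Implicit Arguments.
Unset Strict Implicit.
Unset Printing Implicit Defensive.
Import Order.TTheory GRing.Theory Num.Theory.
Import numFieldNormedType.Exports.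
Local Open Scope classical_set_scope.
Local Open Scope ring_scope.
Local Open Scope ereal_scope.

(** * Inner product: algebra and continuity *)

Lemma dotC (R : realType) (H : lmodType R) (dot : {dot H for idfun}) (x y : H) :
  dot x y = dot y x.
Proof. by rewrite hermC expr0 mul1r. Qed.

Lemma dotDr (R : realType) (H : lmodType R) (dot : {dot H for idfun})
    (x y z : H) : dot x (y + z)%R = (dot x y + dot x z)%R.
Proof. exact: linearDr. Qed.

Lemma dotBr (R : realType) (H : lmodType R) (dot : {dot H for idfun})
    (x y z : H) : dot x (y - z)%R = (dot x y - dot x z)%R.
Proof. exact: linearBr. Qed.

Lemma dotZr (R : realType) (H : lmodType R) (dot : {dot H for idfun})
    (x y : H) (t : R) : dot x (t *: y)%R = (t * dot x y)%R.
Proof. exact: linearZr_LR. Qed.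

Lemma dotxx (R : realType) (H : completeNormedModType R)
    (dot : {dot H for idfun}) (Hdot : hilbert_norm dot) (x : H) :
  dot x x = (`|x| ^+ 2)%R.
Proof.
rewrite Hdot sqr_sqrtr//; have [->|x0] := eqVneq x 0%R.
  by rewrite linear0r.
exact/ltW/neq0_dnorm_gt0.
Qed.

Lemma continuous_dot (R : realType) (H : completeNormedModType R)
    (dot : {dot H for idfun}) (Hdot : hilbert_norm dot) (a : H) :
  continuous (dot a : H -> R).
Proof.
(* Polarization reduces the claim to continuity of the norm. *)
have -> : dot a = (fun x => 2^-1 * (`|a + x| ^+ 2 - `|a| ^+ 2 - `|x| ^+ 2))%R :> (H -> R).
  apply/funext => x; rewrite -!(dotxx Hdot) dotDr !(dotC dot (a + x)%R) !dotDr.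
  by rewrite (dotC dot x a); lra.
move=> x; apply: cvgM; first exact: cvg_cst.
apply: cvgB; last by apply: cvgM; exact: cvg_norm.
apply: cvgB; last exact: cvg_cst.
by apply: cvgM; apply: cvg_norm; apply: cvgD => //; exact: cvg_cst.
Qed.

(** * Suprema of affine functions *)

(** When [b i] is the value of a function at [a i], this is the convex conjugate of its restriction
    to the points [a i]. *)
Definition sup_affine (R : realType) (H : lmodType R) (dot : {dot H for idfun})
    (I : Type) (a : I -> H) (b : I -> R) (x : H) : \bar R :=
  ereal_sup (range (fun i => (dot (a i) x - b i)%:E)).

Lemma sup_affine_ubound (R : realType) (H : lmodType R)
    (dot : {dot H for idfun}) (I : Type) (a : I -> H) (b : I -> R) (x : H)
    (i : I) : (dot (a i) x - b i)%:E <= sup_affine dot a b x.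
Proof. by apply: ereal_sup_ubound; exists i. Qed.

(** The index [i] rules out the empty supremum, which is [-oo]. *)
Lemma sup_affine_ninfty_free (R : realType) (H : lmodType R)
    (dot : {dot H for idfun}) (I : Type) (a : I -> H) (b : I -> R) (i : I) :
  ninfty_free (sup_affine dot a b).
Proof.
move=> x; rewrite -ltNye; apply: (lt_le_trans (ltNyr _)).
exact: (sup_affine_ubound _ _ _ _ i).
Qed.

Lemma sup_affine_convex (R : realType) (H : lmodType R)
    (dot : {dot H for idfun}) (I : Type) (a : I -> H) (b : I -> R) :
  econvex (sup_affine dot a b).
Proof.
move=> x x' t /andP[t0 t1]; apply: ge_ereal_sup => _ [i _ <-].
apply: (@le_trans _ _ (t%:E * (dot (a i) x - b i)%:E
                       + (1 - t)%:E * (dot (a i) x' - b i)%:E)).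
  rewrite -!EFinM -EFinD lee_fin dotDr !dotZr.
  by lra.
by apply: leeD; apply: lee_wpmul2l; rewrite ?sup_affine_ubound//
  lee_fin ?subr_ge0 ltW.
Qed.

(** A member of the family that exceeds [r] at [x] does so on a neighbourhood, and the supremum lies
    above it. *)
Lemma sup_affine_lsc (R : realType) (H : completeNormedModType R)
    (dot : {dot H for idfun}) (Hdot : hilbert_norm dot)
    (I : Type) (a : I -> H) (b : I -> R) :
  lower_semicontinuous (sup_affine dot a b).
Proof.
move=> x r /ereal_sup_gtP[_ [i _ <-]]; rewrite lte_fin => rx.
exists [set z | r < dot (a i) z - b i]%R.
  have c : (fun z => dot (a i) z - b i)%R @ x --> (dot (a i) x - b i)%R.
    by apply: cvgB; [exact: continuous_dot | exact: cvg_cst].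
  exact: (cvgr_gt _ c).
move=> z rz; apply: lt_le_trans (sup_affine_ubound _ _ _ _ i).
by rewrite lte_fin.
Qed.

Lemma sup_affine_max (R : realType) (H : lmodType R)
    (dot : {dot H for idfun}) (I : Type) (a : I -> H) (b : I -> R) (x : H)
    (i : I) (imax : forall j, (dot (a j) x - b j <= dot (a i) x - b i)%R) :
  sup_affine dot a b x = (dot (a i) x - b i)%:E.
Proof.
apply/eqP; rewrite eq_le sup_affine_ubound andbT.
by apply: ge_ereal_sup => _ [j _ <-]; rewrite lee_fin.
Qed.

(** The affine function of index [i] touches the supremum at [x] and stays below it elsewhere. *)
Lemma sup_affine_subdiff (R : realType) (H : lmodType R)
    (dot : {dot H for idfun}) (I : Type) (a : I -> H) (b : I -> R) (x : H)
    (i : I) (imax : forall j, (dot (a j) x - b j <= dot (a i) x - b i)%R) :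
  subdiff dot (sup_affine dot a b) x (a i).
Proof.
rewrite /subdiff /= (sup_affine_max imax); split => [|x'].
  exact: ltry.
apply: le_trans (sup_affine_ubound _ _ _ _ i).
by rewrite -EFinD lee_fin dotBr; lra.
Qed.

(** * Functions sharing subgradients *)

Lemma common_slope_cst (R : realType) (u v s : R -> R) :
  (forall t t', 0 <= t <= 1 -> 0 <= t' <= 1 ->
    u t + s t * (t' - t) <= u t' /\ v t + s t * (t' - t) <= v t')%R ->
  (u 1 - v 1 = u 0 - v 0)%R.
Proof.
move=> hs; pose w t : R := (u t - v t)%R.
(* Used in both orders of [t] and [t'], the hypothesis puts the increments of [u] and [v] between
   [s t * (t' - t)] and [s t' * (t' - t)]. *)
have step t t' : (0 <= t <= 1 -> 0 <= t' <= 1 ->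
    `|w t' - w t| <= (s t' - s t) * (t' - t))%R.
  move=> t01 t'01; have [u1 v1] := hs _ _ t01 t'01.
  have [u2 v2] := hs _ _ t'01 t01.
  by rewrite ler_norml /w; apply/andP; split; lra.
(* On the grid of mesh [1 / N.+1] the increments of [s] telescope. *)
have telescope (N k : nat) : (k <= N.+1)%N ->
    (`|w (k%:R / N.+1%:R) - w 0| <= (s (k%:R / N.+1%:R) - s 0) / N.+1%:R)%R.
  elim: k => [_|k IH kN]; first by rewrite mul0r !subrr normr0 mul0r.
  have in01 (m : nat) : (m <= N.+1)%N -> (0 <= (m%:R / N.+1%:R : R) <= 1)%R.
    by move=> mN; rewrite divr_ge0//= ler_pdivrMr ?mul1r ?ler_nat.
  have := step _ _ (in01 _ (ltnW kN)) (in01 _ kN).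
  rewrite -mulrBl -natrB// subSnn mul1r => h1.
  have := IH (ltnW kN); rewrite !mulrBl in h1 *; move=> h2.
  apply: (le_trans (ler_distD (w (k%:R / N.+1%:R)%R) _ _)).
  by apply: (le_trans (lerD h1 h2)); rewrite addrA subrK.
(* If [w 1] and [w 0] differed, [|w 1 - w 0|] would exceed [(s 1 - s 0) / N.+1] for some [N], by the
   Archimedean property. *)
apply/eqP; rewrite -subr_eq0 -normr_le0 leNgt; apply/negP => e0.
have := archi_boundP (divr_ge0 (normr_ge0 (s 1 - s 0)) (normr_ge0 (w 1 - w 0)))%R.
set N := Num.bound _.
rewrite ltr_pdivrMr// => hN.
have := telescope N _ (leqnn _); rewrite divff ?pnatr_eq0//.
rewrite ler_pdivlMr// => h; have := ler_norm (s 1 - s 0)%R => h'.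
have : (`|w 1 - w 0| * N%:R <= `|w 1 - w 0| * N.+1%:R)%R.
  by rewrite ler_wpM2l// ler_nat.
lra.
Qed.

Lemma subdiff_fin_num (R : realType) (H : lmodType R) (dot : {dot H for idfun})
    (theta : H -> \bar R) (x u : H) :
  ninfty_free theta -> subdiff dot theta x u -> theta x \is a fin_num.
Proof. by move=> free [xfin _]; rewrite fin_numE free -ltey. Qed.

(** The subgradient [v] ensures that [theta z] is finite. *)
Lemma subdiff_fine_le (R : realType) (H : lmodType R) (dot : {dot H for idfun})
    (theta : H -> \bar R) (x u z v : H) :
  ninfty_free theta -> subdiff dot theta x u -> subdiff dot theta z v ->
  (fine (theta x) + dot u (z - x) <= fine (theta z))%R.
Proof.
move=> free xu zv; rewrite -lee_fin EFinD !fineK.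
- by case: xu.
- exact: subdiff_fin_num zv.
- exact: subdiff_fin_num xu.
Qed.

Lemma common_subdiff_segment (R : realType) (H : lmodType R)
    (dot : {dot H for idfun}) (theta1 theta2 : H -> \bar R) (x x' : H) :
  ninfty_free theta1 -> ninfty_free theta2 ->
  (forall z, segment x x' z ->
    exists u, subdiff dot theta1 z u /\ subdiff dot theta2 z u) ->
  (fine (theta1 x') - fine (theta2 x') = fine (theta1 x) - fine (theta2 x))%R.
Proof.
move=> free1 free2 common; pose z t := ((1 - t) *: x + t *: x')%R.
(* Outside [[0, 1]] nothing is required, and [0] is a default value. *)
have /choice[a za] (t : R) : exists u, (0 <= t <= 1)%R ->
    subdiff dot theta1 (z t) u /\ subdiff dot theta2 (z t) u.
  have [t01|] := boolP (0 <= t <= 1)%R; last by exists 0%R.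
  by have [|u] := common (z t); [exists t | exists u].
have /common_slope_cst : forall t t' : R,
    (0 <= t <= 1)%R -> (0 <= t' <= 1)%R ->
    (fine (theta1 (z t)) + dot (a t) (x' - x) * (t' - t) <= fine (theta1 (z t'))
    /\ fine (theta2 (z t)) + dot (a t) (x' - x) * (t' - t)
       <= fine (theta2 (z t')))%R.
  move=> t t' /za[zt1 zt2] /za[zt'1 zt'2].
  have -> : (dot (a t) (x' - x) * (t' - t) = dot (a t) (z t' - z t))%R.
    by rewrite /z !dotBr !dotDr !dotZr; ring.
  by split; apply: subdiff_fine_le; eassumption.
by rewrite /z subrr subr0 !scale0r !scale1r addr0 add0r.
Qed.

(** The difference of the two functions is carried unchanged from vertex to vertex of a path
    starting at a fixed [c], so [K] is its value at [c]. *)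
Lemma common_subdiff_cst (R : realType) (H : lmodType R)
    (dot : {dot H for idfun}) (theta1 theta2 : H -> \bar R) (C : set H) :
  ninfty_free theta1 -> ninfty_free theta2 -> polygonally_connected C ->
  (forall z, C z -> exists u, subdiff dot theta1 z u /\ subdiff dot theta2 z u) ->
  exists K : R, forall x, C x -> theta1 x = theta2 x + K%:E.
Proof.
move=> free1 free2 [[c Cc] Cpath] common.
exists (fine (theta1 c) - fine (theta2 c))%R => x Cx.
have [u [x1 x2]] := common x Cx.
have [n [p [p0 pn pC]]] := Cpath c x Cc Cx.
have cst i : (i <= n)%N -> (fine (theta1 (p i)) - fine (theta2 (p i)) =
    fine (theta1 c) - fine (theta2 c))%R.
  elim: i => [_|i IH lt_in]; first by rewrite p0.
  rewrite -(IH (ltnW lt_in)); apply: (@common_subdiff_segment _ _ dot) => // z.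
  by move=> /(pC i lt_in); exact: common.
rewrite -(cst n)// pn -[theta1 x]fineK ?(subdiff_fin_num free1 x1)//.
by rewrite -[theta2 x]fineK ?(subdiff_fin_num free2 x2)// -EFinD addrC subrK.
Qed.

(* theta' is the convex conjugate of theta restricted to the points b i. *)
Lemma subdiff_conjugate (R : realType) (H : completeNormedModType R)
    (dot : {dot H for idfun}) (Hdot : hilbert_norm dot)
    (I : Type) (i0 : I) (a b : I -> H) (theta : H -> \bar R) :
  ninfty_free theta -> (forall i, subdiff dot theta (b i) (a i)) ->
  exists theta' : H -> \bar R,
    [/\ [/\ ninfty_free theta', econvex theta' & lower_semicontinuous theta'],
        forall i, subdiff dot theta' (a i) (b i) &
        forall i, theta' (a i) = (dot (a i) (b i))%:E - theta (b i)].
Proof.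
move=> free ba; pose h i := fine (theta (b i)).
(* The subgradient inequality at [b i], tested at [b j], says that index [i] attains the supremum at
   [a i]. *)
have imax i j : (dot (b j) (a i) - h j <= dot (b i) (a i) - h i)%R.
  have := subdiff_fine_le free (ba i) (ba j).
  by rewrite dotBr (dotC dot (b j)) (dotC dot (b i)) /h; lra.
exists (sup_affine dot b h); split.
- split; [exact: sup_affine_ninfty_free i0 | exact: sup_affine_convex |].
  exact: sup_affine_lsc.
- by move=> i; apply: sup_affine_subdiff; exact: imax.
- move=> i; rewrite (sup_affine_max (imax i)) EFinB fineK 1?dotC//.
  exact: subdiff_fin_num free (ba i).
Qed.

Lemma prox_subdiff (R : realType) (H : completeNormedModType R)
    (dot : {dot H for idfun}) (Hdot : hilbert_norm dot)
    (phi : H -> \bar R) (y x : H) : ninfty_free phi ->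
  prox phi y x <->
  subdiff dot (fun z => (2^-1 * `|z| ^+ 2)%:E + phi z) x y.
Proof.
move=> free.
(* The term in [|y|] does not depend on [z] and cancels when two objective values are compared. *)
have sqB z : (2^-1 * `|y - z| ^+ 2 =
    2^-1 * `|y| ^+ 2 - dot y z + 2^-1 * `|z| ^+ 2)%R.
  rewrite -!(dotxx Hdot) dotBr !(dotC dot (y - z)%R) !dotBr (dotC dot z y).
  by lra.
rewrite /prox /subdiff /prox_objective /=; split=> -[fin le_x]; split.
- by move: fin; case: (phi x) => //= r _; rewrite ltry.
- move=> z; move: fin (le_x z) (free z); case: (phi x) => [r| |]//= _.
  case: (phi z) => [r'| |]//= + _; last by move=> _; rewrite addey// leey.
  by rewrite -!EFinD !lee_fin !sqB dotBr; lra.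
- by have := free x; move: fin; case: (phi x).
- move=> z; move: fin (le_x z) (free x) (free z); case: (phi x) => [r| |]//= _.
  case: (phi z) => [r'| |]//= + _ _; last by move=> _; rewrite addey// leey.
  by rewrite -!EFinD !lee_fin !sqB dotBr; lra.
Qed.

(** Indexing by [y] instead of by fibres gives (ii) the shape that conjugation handles. *)
Lemma inverse_in_subdiffP (R : realType) (H : completeNormedModType R)
    (dot : {dot H for idfun}) (Y : set H) (f : Y -> H) (g : H -> \bar R) :
  inverse_in_subdiff dot f g <->
  [/\ ninfty_free g, econvex g, lower_semicontinuous g &
      forall y : Y, subdiff dot g (f y) (val y)].
Proof.
split=> -[? ? ? sub]; split=> //.
  by move=> y; apply: (sub (f y)); [exists y | exists y].
by move=> x _ _ [y <- <-]; exact: sub.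
Qed.

(** Adding [chi] keeps the value at [x] and can only raise the others. *)
Lemma subdiff_add_chi (R : realType) (H : lmodType R)
    (dot : {dot H for idfun}) (S : set H) (theta : H -> \bar R) (x u : H) :
  ninfty_free theta -> S x -> subdiff dot theta x u ->
  subdiff dot (fun z => theta z + chi R S z) x u.
Proof.
move=> free Sx [fin le_x]; rewrite /subdiff /chi /= mem_set// adde0.
split=> // z; case: ifPn => _; first by rewrite adde0.
by rewrite addey// leey.
Qed.

Theorem theorem4 (R : realType) (H : completeNormedModType R)
    (dot : {dot H for idfun}) (Hdot : hilbert_norm dot)
    (Y : set H) (Y0 : Y !=set0) (f : Y -> H) :
  (* (a) *)
  ([/\ (exists phi, selects_prox f phi) <->
       (exists g, inverse_in_subdiff dot f g),
       (exists g, inverse_in_subdiff dot f g) <->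
       (exists psi, selects_subdiff dot f psi) &
       (exists phi, selects_prox f phi) ->
       exists phi g psi : H -> \bar R,
         [/\ selects_prox f phi, inverse_in_subdiff dot f g,
             selects_subdiff dot f psi,
             forall x : H, g x + chi R (range f) x =
                           (2^-1 * `|x| ^+ 2)%:E + phi x &
             forall y : Y, psi (val y) =
               (dot (val y) (f y))%:E - (2^-1 * `|f y| ^+ 2)%:E - phi (f y)]])
  /\
  (* (b) *)
  (forall phi g psi : H -> \bar R,
     selects_prox f phi -> inverse_in_subdiff dot f g ->
     selects_subdiff dot f psi ->
     forall C C' : set H, C `<=` range f -> C' `<=` Y ->
       polygonally_connected C -> polygonally_connected C' ->
     exists K K' : R,
       (forall x : H, C x -> g x = (2^-1 * `|x| ^+ 2)%:E + phi x + K%:E) /\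
       (forall y : Y, C' (val y) -> psi (val y) =
          (dot (val y) (f y))%:E - (2^-1 * `|f y| ^+ 2)%:E - phi (f y) + K'%:E)).

Proof.
pose sq (x : H) : \bar R := (2^-1 * `|x| ^+ 2)%:E.
have [y0 _] : exists y0 : Y, True by case: Y0 => y /mem_set Yy; exists (SigSub Yy).
have psi_of (theta : H -> \bar R) : ninfty_free theta ->
    (forall y : Y, subdiff dot theta (f y) (val y)) ->
    exists psi, selects_subdiff dot f psi /\
      forall y : Y, psi (val y) = (dot (val y) (f y))%:E - theta (f y).
  move=> free sub; have [psi [[? ? ?] ? ?]] := subdiff_conjugate Hdot y0 free sub.
  by exists psi.
have g_of psi : selects_subdiff dot f psi ->
    exists g, inverse_in_subdiff dot f g /\
      forall y : Y, g (f y) = (dot (f y) (val y))%:E - psi (val y).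
  move=> [free _ _ sub]; have [g [[? ? ?] ? ?]] := subdiff_conjugate Hdot y0 free sub.
  by exists g; split => //; apply/inverse_in_subdiffP.
(* The witness [g + chi - sq] is well behaved because [sq] is finite, so adding [sq] back recovers
   [g + chi]. *)
have phi_of g : inverse_in_subdiff dot f g ->
    exists phi, selects_prox f phi /\
      forall x, g x + chi R (range f) x = sq x + phi x.
  move=> /inverse_in_subdiffP[free _ _ sub].
  have gE : (fun x => g x + chi R (range f) x) =
      (fun x => sq x + (g x + chi R (range f) x - sq x)).
    by apply/funext => x; rewrite [RHS]addeC subeK.
  exists (fun x => g x + chi R (range f) x - sq x); split; last first.
    by move=> x; rewrite -[LHS]/((fun z => g z + chi R (range f) z) x) gE.
  have free' : ninfty_free (fun x => g x + chi R (range f) x - sq x).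
    by move=> x; have := free x; rewrite /chi; case: (g x) => //= r; case: ifP.
  split=> // y; apply/(prox_subdiff Hdot _ _ free').
  by rewrite -gE; apply: subdiff_add_chi => //; exists y.
have prox_sub phi : selects_prox f phi ->
    ninfty_free (fun x => sq x + phi x) /\
    forall y : Y, subdiff dot (fun x => sq x + phi x) (f y) (val y).
  move=> [free sel]; split=> [x | y]; last exact/(prox_subdiff Hdot).
  by have := free x; case: (phi x).
(* The chain goes from [phi] to [psi], then [g], then a new [phi'], which replaces [phi]. At [f y]
   the term [chi] vanishes, so the values of [g] there give the formula for [psi]. *)
have joint phi : selects_prox f phi -> exists phi g psi : H -> \bar R,
    [/\ selects_prox f phi, inverse_in_subdiff dot f g,
        selects_subdiff dot f psi,
        forall x : H, g x + chi R (range f) x = sq x + phi x &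
        forall y : Y, psi (val y) =
          (dot (val y) (f y))%:E - sq (f y) - phi (f y)].
  move=> /prox_sub[free sub].
  have [psi [psi_sub psiE]] := psi_of _ free sub.
  have [g [g_inv gE]] := g_of _ psi_sub.
  have [phi' [phi'_prox phi'E]] := phi_of _ g_inv.
  exists phi', g, psi; split=> // y.
  have [psi_free _ _ /(_ y)/(subdiff_fin_num psi_free)] := psi_sub.
  have := phi'E (f y); rewrite /chi mem_set; last by exists y.
  rewrite adde0 gE (dotC dot (f y)); case: (psi (val y)) => //= r.
  case: (phi' (f y)) => // r' [e] _; congr EFin; lra.
split.
  split.
  - split=> [[phi /joint[_ [g [_ [_ ? _ _ _]]]]]|[g /phi_of[phi [? _]]]].
      by exists g.
    by exists phi.
  - split=> [[g /inverse_in_subdiffP[free _ _ sub]]|[psi /g_of[g [? _]]]].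
      by have [psi [? _]] := psi_of _ free sub; exists psi.
    by exists g.
  - by move=> [phi]; exact: joint.
move=> phi g psi /prox_sub[phi_free phi_sub] /inverse_in_subdiffP[g_free _ _ g_sub].
move=> [psi_free _ _ psi_sub] C C' Cf C'Y Ccon C'con.
(* On [Y] the function [psi'] equals the right-hand side sought without its constant, so [psi] is
   compared with [psi']. *)
have [psi' [[psi'_free _ _ psi'_sub] psi'E]] := psi_of _ phi_free phi_sub.
have [K gK] : exists K : R, forall x, C x -> g x = sq x + phi x + K%:E.
  apply: (common_subdiff_cst (dot := dot)) => // z /Cf[y _ <-].
  by exists (val y); split.
have [K' psiK] : exists K : R, forall x, C' x -> psi x = psi' x + K%:E.
  apply: (common_subdiff_cst (dot := dot)) => // z /C'Y/mem_set Yz.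
  by exists (f (SigSub Yz)); split; [exact: (psi_sub (SigSub Yz))
    | exact: (psi'_sub (SigSub Yz))].
exists K, K'; split=> // y /psiK ->; rewrite psi'E.
by rewrite oppeD ?fin_num_adde_defr// addeA.
Qed.
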